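(* Let $H$, $W$, $R$, $c$, $C$, $\tilde\delta$, $\eta$, $\delta$, $\theta^\ast$, $B^\ast$, $\ell$, $\pi$, $\gamma$, $\mathcal{Z}_\gamma$ be as defined in the context, and suppose the following four assumptions hold. (1) (Likelihood ratio: deterministic part) There exist a fixed $d\times d$ positive definite matrix $H$ and a constant $c\in(1/2,1)$ such that for all $\theta\in B^\ast$, $$\frac{(\theta-\theta^\ast)'H(\theta-\theta^\ast)}{2c}\ \ge\ -\mathbb{E}\,\ell(\theta,\theta^\ast)\ \ge\ \frac{(\theta-\theta^\ast)'H(\theta-\theta^\ast)}{2}.$$ (2) (Likelihood ratio: stochastic part) There exist a positive constant $C$ and $\tilde\delta\in(0,1/4)$ such that $\mathbb{P}\big\{\sup_{\theta\in B^\ast}|\ell_r(\theta)-\ell_r(\theta^\ast)|\le C\,d\big\}\ge 1-\tilde\delta$. (3) (Prior) The prior density $\pi$ is continuous and nowhere zero on $\Theta$. (4) (Posterior concentration) There exist constants $\eta,\delta\in(0,1/4)$ such that $\mathbb{P}\{\gamma(B^\ast)\ge 1-\eta\}\ge 1-\delta$. Then, with $\mathbb{P}$-probability at least $1-\delta-\tilde\delta$, both of the following bounds hold: $$\log\mathcal{Z}_\gamma\ \le\ \ell(\theta^\ast)-\frac{\log|H|}{2}+\bigg[C_1 d+\log\bigg\{\frac{\sup_{\theta\in B^\ast}\pi(\theta)}{1-\eta}\bigg\}+\log P(\|\xi\|^2\le R\,d)\bigg],$$ where $C_1=C+\log(2\pi)/2$ (here $\pi$ is the number $3.14\ldots$)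 and $\xi\sim\mathcal{N}_d(0,W^{1/2}H^{-1}W^{1/2})$; and $$\log\mathcal{Z}_\gamma\ \ge\ \ell(\theta^\ast)-\frac{\log|H|}{2}+\bigg\{C_2 d+\log\inf_{\theta\in B^\ast}\pi(\theta)+\log P(\|\xi\|^2\le R\,c^{-1}d)\bigg\},$$ where $C_2=-C+\log(2\pi)/2+(\log c)/2$ and $\xi$ is as before.
   Context: Data $Y$ take values in a sample space $\mathcal{Y}$ and are modeled by a family $\{\mathbb{P}_\theta:\theta\in\Theta\}$, where $\Theta\subseteq\mathbb{R}^d$ is a closed convex set. Each $\mathbb{P}_\theta$ has density $p_\theta=d\mathbb{P}_\theta/d\mu$ with respect to a common $\sigma$-finite measure $\mu$ on $\mathcal{Y}$, and $(y,\theta)\mapsto p_\theta(y)$ is jointly measurable. The log-likelihood is $\ell(\theta)=\log p_\theta(Y)$, and $\ell(\theta,\theta^\dagger)=\ell(\theta)-\ell(\theta^\dagger)$. $\pi(\cdot)$ is a continuous proper prior density on $\Theta$. The posterior $\gamma$ and the marginal likelihood $\mathcal{Z}_\gamma$ are $$\gamma(B)=\frac{\int_B e^{\ell(\theta)}\pi(\theta)\,d\theta}{\mathcal{Z}_\gamma}\ (B\text{ measurable}),\qquad \mathcal{Z}_\gamma=\int_\Theta e^{\ell(\theta)}\pi(\theta)\,d\theta.$$ The model may be misspecified: the true distribution $\mathbb{P}$ of $Y$ need not belong to $\{\mathbb{P}_\theta\}$; it satisfies $\mathbb{P}\ll\mu$, with density $p=d\mathbb{P}/d\mu$. $\mathbb{E}$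 denotes expectation with respect to $\mathbb{P}$. The pseudo-true parameter is $$\theta^\ast=\arg\min_{\theta\in\Theta}D(p\,\|\,p_\theta)=\arg\max_{\theta\in\Theta}\mathbb{E}\,\ell(\theta),$$ where $D(p\,\|\,q)=E_p(\log p/q)$ is the Kullback--Leibler divergence. Set $\ell_r(\theta)=\ell(\theta)-\mathbb{E}\,\ell(\theta)$. For a fixed $d\times d$ positive definite matrix $W$ and a constant $R>0$, $B^\ast=\{\theta\in\Theta:(\theta-\theta^\ast)'W(\theta-\theta^\ast)\le R\,d\}$. $|H|$ denotes the determinant of $H$, $\|\cdot\|$ the Euclidean norm, and $\mathcal{N}_d$ the $d$-variate normal distribution; $P$ denotes probability under the law of $\xi$.
   Formalization: The lower bound on log Z_γ is proved only when the full ellipsoid {θ∈R^d: (θ−θ* )'W(θ−θ* ) ≤ R d} lies in Θ; as printed it is false when Θ cuts through that ellipsoid (e.g. Θ=[0,e], e small, Gaussian location model). *)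

(* Defs.v *)
From HB Require Import structures.
From mathcomp Require Import all_boot all_order all_algebra.
From mathcomp Require Import all_classical all_reals all_analysis.
From mathcomp Require Import measurable_realfun.

Set Implicit Arguments.
Unset Strict Implicit.
Unset Printing Implicit Defensive.

Import Order.TTheory GRing.Theory Num.Theory.
Import numFieldTopology.Exports numFieldNormedType.Exports.

Local Open Scope classical_set_scope.
Local Open Scope ring_scope.

(* Matrices over R carry the Borel sigma-algebra of their topology. *)
Section matrix_borel.
Variables (R : realType) (m n : nat).

Definition measurable_matrix : set (set 'M[R]_(m, n)) := <<s @open 'M[R]_(m, n) >>.

HB.instance Definition _ :=
  @isMeasurable.Build (sigma_display (@open 'M[R]_(m, n))) 'M[R]_(m, n)
    measurable_matrix
    (@sigma_algebra0 _ _ _) (@sigma_algebraC _ _)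
    (@sigma_algebra_bigcup _ setT _).

Lemma open_measurable_matrix (A : set 'M[R]_(m, n)) : open A -> measurable A.
Proof. exact: sub_sigma_algebra. Qed.

End matrix_borel.

Section pushforward_sigma_finite.
Context d1 d2 (T1 : measurableType d1) (T2 : measurableType d2) (R : realType).
Variables (mu : {measure set T1 -> \bar R}).
Hypothesis sfmu : sigma_finite setT mu.
Variables (f : T1 -> T2) (g : T2 -> T1).
Hypotheses (mf : measurable_fun setT f) (mg : measurable_fun setT g).
Hypothesis fK : cancel f g.

Let nu : set T2 -> \bar R := pushforward mu f.
Let nu0 : nu set0 = 0%E.
Proof. by rewrite /nu /pushforward preimage_set0 measure0. Qed.
Let nu_ge0 A : (0 <= nu A)%E.
Proof. exact: measure_ge0. Qed.
Let nu_sigma_additive : semi_sigma_additive nu.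
Proof.
exact: (@measure_semi_sigma_additive _ _ _ (@pushforward _ _ T1 T2 R mu f)).
Qed.
Let nu_sigma_finite : sigma_finite setT nu.
Proof.
have [F TF Foo] := sfmu.
have mgF k : measurable (g @^-1` F k).
  by rewrite -[X in measurable X]setTI; apply: mg => //; case: (Foo k).
exists (fun k => g @^-1` F k).
  by rewrite -preimage_bigcup -TF preimage_setT.
move=> k; split => //.
rewrite /nu /pushforward -comp_preimage (_ : g \o f = id) ?preimage_id.
  by case: (Foo k).
by apply/funext => x /=; rewrite fK.
Qed.

Definition sigma_finite_pushforward_fun := nu.
HB.instance Definition _ := isMeasure.Build _ _ _ sigma_finite_pushforward_fun
  nu0 nu_ge0 nu_sigma_additive.
HB.instance Definition _ := Measure_isSigmaFinite.Build _ _ _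
  sigma_finite_pushforward_fun nu_sigma_finite.
Definition sigma_finite_pushforward :
  {sigma_finite_measure set T2 -> \bar R} := sigma_finite_pushforward_fun.
End pushforward_sigma_finite.

(* product_measure1's own sigma-finite instance is shadowed by the one for
   subprobabilities. *)
Lemma product_measure_sigma_finite d1 d2 (T1 : measurableType d1)
    (T2 : measurableType d2) (R : realType)
    (m1 : {sigma_finite_measure set T1 -> \bar R})
    (m2 : {sigma_finite_measure set T2 -> \bar R}) :
  sigma_finite setT (m1 \x m2)%E.
Proof.
have /sigma_finiteP[F [TF ndF Foo]] := sigma_finiteT m1.
have /sigma_finiteP[G [TG ndG Goo]] := sigma_finiteT m2.
exists (fun n => F n `*` G n).
  rewrite -setXTT TF TG predeqE => -[x y]; split.
    move=> [/= [n _ Fnx] [k _ Gky]]; exists (maxn n k) => //; split.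
    - by move: x Fnx; exact/subsetPset/ndF/leq_maxl.
    - by move: y Gky; exact/subsetPset/ndG/leq_maxr.
  by move=> [n _ []/= ? ?]; split; exists n.
move=> k; have [? ?] := Foo k; have [? ?] := Goo k.
split; first exact: measurableX.
by rewrite product_measure1E// lte_mul_pinfty// ge0_fin_numE.
Qed.

Section lebesgue_tuple.
Variable R : realType.

Definition tcons n (x : measurableTypeR R * n.-tuple (measurableTypeR R)) :
  n.+1.-tuple (measurableTypeR R) := [tuple of x.1 :: x.2].
Definition tuncons n (x : n.+1.-tuple (measurableTypeR R)) :
  measurableTypeR R * n.-tuple (measurableTypeR R) :=
  (thead x, [tuple of behead x]).

Lemma tconsK n : cancel (@tcons n) (@tuncons n).
Proof.
move=> [a t]; rewrite /tuncons /tcons theadE; congr (_, _).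
exact/val_inj.
Qed.

Lemma measurable_tcons n : measurable_fun setT (@tcons n).
Proof. exact: measurable_cons. Qed.

Lemma measurable_tuncons n : measurable_fun setT (@tuncons n).
Proof.
apply: measurable_fun_pair; first exact: measurable_tnth.
exact: measurable_behead.
Qed.

Definition lebesgue_cons n
    (nu : {sigma_finite_measure set (n.-tuple (measurableTypeR R)) -> \bar R}) :
    {sigma_finite_measure set (n.+1.-tuple (measurableTypeR R)) -> \bar R} :=
  sigma_finite_pushforward
    (product_measure_sigma_finite (@lebesgue_measure R) nu)
    (@measurable_tcons n) (@measurable_tuncons n) (@tconsK n).

Fixpoint lebesgue_tuple n :
    {sigma_finite_measure set (n.-tuple (measurableTypeR R)) -> \bar R} :=
  match n with
  | 0 => \d_([tuple] : 0.-tuple (measurableTypeR R))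
  | n'.+1 => lebesgue_cons (lebesgue_tuple n')
  end.

Lemma lebesgue_tuple_box n (A : 'I_n -> set R) : (forall i, measurable (A i)) ->
  lebesgue_tuple n [set t | forall i, A i (tnth t i)] =
  (\prod_(i < n) lebesgue_measure (A i))%E.
Proof.
elim: n A => [|n IH] A mA.
  by rewrite big_ord0 /= diracE mem_set //; case.
rewrite big_ord_recl -IH//.
have mbox : measurable
    ([set t | forall i : 'I_n, A (lift ord0 i) (tnth t i)] :
      set (n.-tuple (measurableTypeR R))).
  rewrite (_ : [set _ | _] = \bigcap_(i in [set: 'I_n])
      ((@tnth n (measurableTypeR R))^~ i @^-1` A (lift ord0 i))); last first.
    by apply/seteqP; split => t /= h i; [move=> _; exact: h|exact: h].
  apply: fin_bigcap_measurable => // i _.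
  rewrite -[X in measurable X]setTI.
  apply: (@measurable_tnth _ (measurableTypeR R)) => //.
  exact: mA.
rewrite -product_measure1E//=; last exact: mA.
rewrite /sigma_finite_pushforward_fun /pushforward; congr (_ _).
apply/seteqP; split => -[a t] /= h.
  split; first by have := h ord0; rewrite tnth0.
  by move=> i; have := h (lift ord0 i); rewrite tnthS.
by move=> i; case: (unliftP ord0 i) => [j|] ->; rewrite ?tnthS ?tnth0; case: h.
Qed.

End lebesgue_tuple.

Section lebesgue_vec.
Variables (R : realType) (d : nat).

Definition vec_of_tuple (t : d.-tuple (measurableTypeR R)) : 'cV[R]_d :=
  \col_i tnth t i.
Definition tuple_of_vec (x : 'cV[R]_d) : d.-tuple (measurableTypeR R) :=
  [tuple x i ord0 | i < d].

Lemma vec_of_tupleK : cancel vec_of_tuple tuple_of_vec.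
Proof. by move=> t; apply/eq_from_tnth => i; rewrite tnth_mktuple mxE. Qed.

Lemma measurable_tuple_of_vec : measurable_fun setT tuple_of_vec.
Proof.
apply/measurable_fun_tnthP => i.
rewrite (_ : _ \o _ = fun x : 'cV[R]_d => x i ord0); last first.
  by apply/funext => x /=; rewrite tnth_mktuple.
apply: (@measurability _ _ _ (measurableTypeR R) _ _
  (@RGenOInfty.G R)).
  exact: RGenOInfty.measurableE.
move=> _ [_ [a ->] <-]; rewrite setTI.
apply: open_measurable_matrix; apply: open_comp; last exact: rray_open.
by move=> x _; exact: coord_continuous.
Qed.

Lemma measurable_vec_of_tuple : measurable_fun setT vec_of_tuple.
Proof.
apply: (@measurability _ _ _ _ _ _ (@open 'M[R]_(d, 1))) => // _ [U oU <-].
rewrite setTI.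
pose box (z : d.-tuple rat * nat) : set (d.-tuple (measurableTypeR R)) :=
  \bigcap_(i in [set: 'I_d]) ((@tnth d (measurableTypeR R))^~ i @^-1`
    (ball (ratr (tnth z.1 i) : R) (z.2.+1%:R^-1))).
have mbox z : measurable (box z).
  apply: fin_bigcap_measurable => // i _.
  rewrite -[X in measurable X]setTI.
  by apply: (@measurable_tnth _ (measurableTypeR R)) => //; apply: open_measurable; exact: ball_open.
have -> : vec_of_tuple @^-1` U =
    \bigcup_(z in [set: d.-tuple rat * nat])
      (if `[< box z `<=` vec_of_tuple @^-1` U >] then box z else set0).
  apply/seteqP; split => [t Ut|t [z _]]; last by case: asboolP => // h /h.
  have /nbhs_ballP[e /= e0 eU] : nbhs (vec_of_tuple t) U by exact: open_nbhs_nbhs.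
  have [k ke] : exists k : nat, k.+1%:R^-1 < e / 2.
    by have [k _ /(_ k) H] := near_infty_natSinv_lt (PosNum (divr_gt0 e0 (ltr0n R 2)));
       exists k; exact: H (leqnn k).
  have /choice[q qP] : forall i : 'I_d, exists q : rat,
      ball (ratr q : R) k.+1%:R^-1 (tnth t i).
    move=> i; have [|q] := @rat_in_itvoo R (tnth t i - k.+1%:R^-1) (tnth t i + k.+1%:R^-1).
      by rewrite ltrD2l gtrN// invr_gt0.
    by rewrite in_itv/= => q12; exists q; rewrite /ball/= ltr_distl.
  exists ([tuple q i | i < d], k) => //; case: asboolP => [_|[]].
    by move=> i _ /=; rewrite tnth_mktuple.
  move=> u bu; apply: eU; split => // i j; rewrite !mxE.
  have /= := bu i Logic.I; rewrite tnth_mktuple => qu.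
  have qt := @le_ball _ R _ _ _ (ltW ke) _ (qP i).
  have qu' := @le_ball _ R _ _ _ (ltW ke) _ qu.
  exact: (@ball_splitr _ R (ratr (q i))).
apply: countable_bigcupT_measurable => //.
by move=> z; case: ifP.
Qed.

Definition lebesgue_vec : {sigma_finite_measure set 'cV[R]_d -> \bar R} :=
  sigma_finite_pushforward (sigma_finiteT (lebesgue_tuple R d)) measurable_vec_of_tuple
    measurable_tuple_of_vec vec_of_tupleK.

Lemma lebesgue_vec_box (A : 'I_d -> set R) : (forall i, measurable (A i)) ->
  lebesgue_vec [set x | forall i, A i (x i ord0)] =
  (\prod_(i < d) lebesgue_measure (A i))%E.
Proof.
move=> mA; rewrite -lebesgue_tuple_box//=.
rewrite /sigma_finite_pushforward_fun /pushforward; congr (_ _).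
by apply/seteqP; split => t /= h i; have := h i; rewrite mxE.
Qed.

End lebesgue_vec.

Section linear_algebra.
Variables (R : realType) (d : nat).
Implicit Types (M S : 'M[R]_d) (v : 'cV[R]_d).

Definition qform M v : R := (v^T *m M *m v) ord0 ord0.

Definition posdefmx M := M^T = M /\ forall v, v != 0 -> 0 < qform M v.

(* The positive definite square root, which is unique when it exists. *)
Definition is_sqrtmx M S := posdefmx S /\ S *m S = M.

(* The library norm `|v| on matrices is the sup norm. *)
Definition enorm v : R := Num.sqrt (\sum_i v i ord0 ^+ 2).

(* Only meaningful for a positive definite covariance matrix S. *)
Definition mvnormal_pdf v S (x : 'cV[R]_d) : R :=
  (Num.sqrt ((2 * pi) ^+ d * \det S))^-1 *
  expR (- qform (invmx S) (x - v) / 2).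

Definition mvnormal_prob v S (A : set 'cV[R]_d) : \bar R :=
  (\int[@lebesgue_vec R d]_(x in A) (mvnormal_pdf v S x)%:E)%E.

End linear_algebra.

Section probability_notions.
Local Open Scope ereal_scope.
Context dY (Y : measurableType dY) (R : realType).

(* Phrased through a measurable subevent because a supremum over uncountably
   many parameters need not be a measurable function of the data; for a
   measurable event A this is just r <= P A. *)
Definition prob_ge (P : probability Y R) (A : set Y) (r : R) :=
  exists E : set Y, [/\ measurable E, E `<=` A & r%:E <= P E].

Definition is_density (mu : {measure set Y -> \bar R}) (P : probability Y R)
    (f : Y -> R) :=
  [/\ measurable_fun setT f, forall y, (0 <= f y)%R &
      forall A, measurable A -> P A = \int[mu]_(y in A) (f y)%:E].

Definition KL (mu : {measure set Y -> \bar R}) (p q : Y -> R) : \bar R :=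
  \int[mu]_y ((p y)%:E * lne ((p y)%:E / (q y)%:E)).

End probability_notions.

(* The log-likelihood is extended-real valued, with value -oo where the density
   vanishes. *)
Section likelihood.
Local Open Scope ereal_scope.
Context dY (Y : measurableType dY) (R : realType) (d : nat).
Variable p : 'cV[R]_d -> Y -> R.
Implicit Types (P : probability Y R) (theta : 'cV[R]_d) (y : Y).

Definition loglik theta y : \bar R := lne (p theta y)%:E.

Definition loglik_ratio theta theta' y := loglik theta y - loglik theta' y.

Definition centered_loglik P theta y :=
  loglik theta y - \int[P]_z loglik theta z.

Definition unnormalized_posterior (prior : 'cV[R]_d -> R) y
    (B : set 'cV[R]_d) :=
  \int[@lebesgue_vec R d]_(theta in B)
    (expeR (loglik theta y) * (prior theta)%:E).

Definition marginal_likelihood (Theta : set 'cV[R]_d) prior y :=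
  unnormalized_posterior prior y Theta.

Definition posterior (Theta : set 'cV[R]_d) prior y (B : set 'cV[R]_d) :=
  unnormalized_posterior prior y B / marginal_likelihood Theta prior y.

Definition pseudo_true (mu : {measure set Y -> \bar R}) P (p0 : Y -> R)
    (Theta : set 'cV[R]_d) theta :=
  [/\ Theta theta,
      forall t, Theta t -> KL mu p0 (p theta) <= KL mu p0 (p t) &
      forall t, Theta t -> \int[P]_y loglik t y <= \int[P]_y loglik theta y].

End likelihood.

Definition ellipsoid (R : realType) d (W : 'M[R]_d) (r : R) (v : 'cV[R]_d) :=
  [set theta | qform W (theta - v) <= r * d%:R].

Definition Bstar (R : realType) d (Theta : set 'cV[R]_d) (W : 'M[R]_d) (r : R)
    (v : 'cV[R]_d) :=
  Theta `&` ellipsoid W r v.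

(* Main.v *)
(* On B* the hypotheses squeeze the log-likelihood ratio at theta between two
   quadratic forms in theta - theta^*, up to an error C d. Hence the
   unnormalized posterior mass of B* is compared with Gaussian integrals over
   the ellipsoid, and posterior concentration relates that mass to Z. The
   substitution x = c^{-1/2} W^{1/2} (theta - theta^* ) turns the Gaussian
   integrals into probabilities P(|xi|^2 <= R d / c). It needs the linear
   change of variables only for positive definite matrices, where it follows by
   induction on the dimension: splitting off one coordinate by Tonelli, a
   one-dimensional affine substitution leaves the Schur complement, which is
   again positive definite, and a translation. *)
Require Import Defs.
From HB Require Import structures.
From mathcomp Require Import all_boot all_order all_algebra.
From mathcomp Require Import all_classical all_reals all_analysis.
From mathcomp Require Import measurable_realfun.
From mathcomp Require Import ring lra.

Set Implicit Arguments.
Unset Strict Implicit.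
Unset Printing Implicit Defensive.

Import Order.TTheory GRing.Theory Num.Theory.
Import numFieldTopology.Exports numFieldNormedType.Exports.

Local Open Scope classical_set_scope.
Local Open Scope ring_scope.

(** * Linear change of variables in R^d *)

Lemma ge0_integral_pushforwardT d1 d2 (X : measurableType d1)
    (Y : measurableType d2) (R : realType) (mu : {measure set X -> \bar R})
    (phi : X -> Y) (mphi : measurable_fun setT phi) (f : Y -> \bar R) :
    measurable_fun setT f -> (forall y, 0 <= f y)%E ->
  (\int[pushforward mu phi]_y f y = \int[mu]_x f (phi x))%E.
Proof. by move=> mf f0; rewrite ge0_integral_pushforward. Qed.

(** * Affine substitution on the real line *)

Section one_dimensional.
Variable R : realType.
Implicit Types (a b : R) (f : measurableTypeR R -> \bar R).

Lemma measurable_affine a b :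
  measurable_fun setT
    (fun x : measurableTypeR R => a * x + b : measurableTypeR R).
Proof.
apply: continuous_measurable_fun => x.
by apply: cvgD; [apply: cvgM; [exact: cvg_cst|exact: cvg_id]|exact: cvg_cst].
Qed.

(** The pushforward of Lebesgue measure under the affine map, scaled by [a], gives half-open
    intervals their length, so by uniqueness it is Lebesgue measure. *)
Lemma ge0_integral_affine a b f : 0 < a -> measurable_fun setT f ->
    (forall x, 0 <= f x)%E ->
  (a%:E * \int[@lebesgue_measure R]_x f (a * x + b)%R =
    \int[@lebesgue_measure R]_x f x)%E.
Proof.
move=> a0 mf f0.
have mab := measurable_affine a b.
rewrite -(ge0_integral_pushforwardT _ mab) //.
(* [mscale] takes its factor as a bundled nonnegative number. *)
have -> : a%:E = ((NngNum (ltW a0))%:num)%:E by [].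
rewrite -ge0_integral_mscale//.
apply: eq_measure_integral => A mA _; apply/esym.
apply: lebesgue_measure_unique => // _ [[x y] _ <-] /=.
rewrite /mscale/= /pushforward/=.
rewrite (_ : _ @^-1` _ = `](x - b) / a, (y - b) / a]%classic); last first.
  apply/seteqP; split => z /=;
    by rewrite !in_itv/= ltr_pdivrMr// ler_pdivlMr// ltrBlDr lerBrDr mulrC.
rewrite !lebesgue_measure_itv/= !lte_fin ltr_pM2r ?invr_gt0// ltrD2r.
case: ifPn => _; last by rewrite mule0.
by rewrite -!EFinB -EFinM; congr (_%:E); field; rewrite gt_eqF.
Qed.

End one_dimensional.

(** * Splitting off the first coordinate *)

Section vcons.
Variable R : realType.

(** [col_mx] yields size [1 + n], convertible to [n.+1]; the block lemmas below are therefore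
    applied with explicit dimensions. *)
Definition vcons n (x : measurableTypeR R) (t : 'cV[R]_n) : 'cV[R]_n.+1 :=
  col_mx (x%:M : 'cV_1) t.

(** Links [vcons] to [tcons], through which Lebesgue measure on tuples is built. *)
Lemma vconsE n (z : measurableTypeR R * 'cV[R]_n) :
  vcons z.1 z.2 = vec_of_tuple (tcons (z.1, tuple_of_vec z.2)).
Proof.
apply/matrixP => i j; rewrite ord1 [RHS]mxE /vcons /tcons.
case: (@unliftP n.+1 ord0 i) => [k ->|->]; last first.
  rewrite tnth0; have := @col_mxEu R 1 n 1 z.1%:M z.2 ord0 ord0.
  rewrite [X in _ = X]mxE eqxx mulr1n => e; rewrite -[RHS]e.
  by congr (fun_of_matrix _ _ _); exact/val_inj.
rewrite tnthS tnth_mktuple.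
have := @col_mxEd R 1 n 1 z.1%:M z.2 k ord0.
by move=> <-; congr (fun_of_matrix _ _ _); exact/val_inj.
Qed.

Lemma measurable_vcons n :
  measurable_fun setT (fun z : measurableTypeR R * 'cV[R]_n => vcons z.1 z.2).
Proof.
rewrite (eq_fun (@vconsE n)).
apply: measurableT_comp; first exact: measurable_vec_of_tuple.
apply: measurableT_comp; first exact: measurable_tcons.
apply: measurable_fun_pair => //.
exact: (measurableT_comp (@measurable_tuple_of_vec R n)).
Qed.

Lemma ge0_integral_vec n (f : 'cV[R]_n -> \bar R) : measurable_fun setT f ->
    (forall x, 0 <= f x)%E ->
  (\int[@lebesgue_vec R n]_x f x =
    \int[@lebesgue_tuple R n]_t f (vec_of_tuple t))%E.
Proof.
move=> mf f0.
by rewrite -(ge0_integral_pushforwardT _ (@measurable_vec_of_tuple R n)).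
Qed.

(** On tuples the measure in dimension [n.+1] is by construction a pushforward of a product, so this
    is Tonelli's theorem, transported to tuples and back. *)
Lemma ge0_integral_vcons n (f : 'cV[R]_n.+1 -> \bar R) :
    measurable_fun setT f -> (forall x, 0 <= f x)%E ->
  (\int[@lebesgue_vec R n.+1]_x f x =
    \int[@lebesgue_measure R]_x \int[@lebesgue_vec R n]_t f (vcons x t))%E.
Proof.
move=> mf f0; rewrite ge0_integral_vec//=.
have mfv := measurableT_comp mf (@measurable_vec_of_tuple R n.+1).
transitivity (\int[(@lebesgue_measure R) \x (@lebesgue_tuple R n)]_z
    (f \o @vec_of_tuple R n.+1 \o @tcons R n) z)%E.
  rewrite -(ge0_integral_pushforwardT _ (@measurable_tcons R n) mfv).
    by apply: eq_measure_integral => //; exact: measurable_tcons. 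
  by move=> t; exact: f0.
rewrite fubini_tonelli1//; last by move=> z; exact: f0.
  apply: eq_integral => x _; rewrite /fubini_F ge0_integral_vec//=.
  - apply: eq_integral => t _ /=; congr f.
    by rewrite (vconsE (x, vec_of_tuple t)) /= vec_of_tupleK.
  - apply: (measurableT_comp mf).
    exact: (measurableT_comp (@measurable_vcons n) (pair1_measurable _)).
exact: (measurableT_comp mfv (@measurable_tcons R n)).
Qed.

End vcons.

(** * Measurability of vector-valued maps *)

Section measurable_vectors.
Variable R : realType.

Lemma measurable_coord d (i : 'I_d) :
  measurable_fun setT (fun x : 'cV[R]_d => x i ord0 : measurableTypeR R).
Proof.
rewrite (_ : (fun _ => _) =
    (@tnth d (measurableTypeR R))^~ i \o @tuple_of_vec R d).
  apply: measurableT_comp; last exact: measurable_tuple_of_vec.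
  exact: measurable_tnth.
by apply/funext => x /=; rewrite tnth_mktuple.
Qed.

(** Factor [g] through tuples, where measurability is coordinatewise. *)
Lemma measurable_vec d dT (T : measurableType dT) (g : T -> 'cV[R]_d) :
  (forall i, measurable_fun setT (fun w => g w i ord0 : measurableTypeR R)) ->
  measurable_fun setT g.
Proof.
move=> mg; rewrite (_ : g = @vec_of_tuple R d \o (fun w => tuple_of_vec (g w))).
  apply: measurableT_comp; first exact: measurable_vec_of_tuple.
  apply/measurable_fun_tnthP => i.
  rewrite (_ : _ \o _ = fun w => g w i ord0); first exact: mg.
  by apply/funext => w /=; rewrite tnth_mktuple.
apply/funext => w /=; apply/matrixP => i j.
by rewrite ord1 mxE tnth_mktuple.
Qed.

Lemma measurable_add_vec d dT (T : measurableType dT) (g h : T -> 'cV[R]_d) :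
  measurable_fun setT g -> measurable_fun setT h ->
  measurable_fun setT (fun w => g w + h w).
Proof.
move=> mg mh; apply: measurable_vec => i.
under eq_fun do rewrite mxE.
by apply: measurable_funD; exact: (measurableT_comp (measurable_coord i)).
Qed.

Lemma measurable_scale_vec d dT (T : measurableType dT)
    (g : T -> measurableTypeR R) (v : 'cV[R]_d) :
  measurable_fun setT g -> measurable_fun setT (fun w => g w *: v).
Proof.
move=> mg; apply: measurable_vec => i.
under eq_fun do rewrite mxE.
exact: measurable_funM.
Qed.

Lemma measurable_mulmx m n dT (T : measurableType dT) (g : T -> 'cV[R]_n)
    (M : 'M[R]_(m, n)) :
  measurable_fun setT g -> measurable_fun setT (fun w => M *m g w).
Proof.
move=> mg; apply: measurable_vec => i.
under eq_fun do rewrite mxE.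
apply: measurable_sum => j; apply: measurable_funM => //.
exact: (measurableT_comp (measurable_coord j)).
Qed.

Lemma measurable_qform d (M : 'M[R]_d) :
  measurable_fun setT (fun x : 'cV[R]_d => qform M x : measurableTypeR R).
Proof.
rewrite /qform; under eq_fun do rewrite -mulmxA mxE.
apply: measurable_sum => j; under eq_fun do rewrite mxE.
apply: measurable_funM; first exact: measurable_coord.
apply: (measurableT_comp (measurable_coord j)).
by apply: measurable_mulmx; exact: measurable_id.
Qed.

Lemma enorm2E d (x : 'cV[R]_d) : enorm x ^+ 2 = \sum_i x i ord0 ^+ 2.
Proof. by rewrite sqr_sqrtr// sumr_ge0// => i _; exact: sqr_ge0. Qed.

Lemma measurable_enorm2 d :
  measurable_fun setT (fun x : 'cV[R]_d => enorm x ^+ 2 : measurableTypeR R).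
Proof.
under eq_fun do rewrite enorm2E.
apply: measurable_sum => j; exact: (measurable_funX 2 (measurable_coord j)).
Qed.

Lemma measurable_fun_vcons n dT (T : measurableType dT)
    (g : T -> measurableTypeR R) (h : T -> 'cV[R]_n) :
  measurable_fun setT g -> measurable_fun setT h ->
  measurable_fun setT (fun w => vcons (g w) (h w)).
Proof.
move=> mg mh.
exact: (measurableT_comp (@measurable_vcons R n) (measurable_fun_pair mg mh)).
Qed.

End measurable_vectors.

(** * Positive definite block matrices and Schur complements *)

Section posdef_blocks.
Variables (R : realType) (n : nat).
Implicit Types (a : R) (u : 'rV[R]_n) (N : 'M[R]_n).

Definition schur a u N := N - a^-1 *: (u^T *m u).

Lemma posdefmx_block (M : 'M[R]_n.+1) : posdefmx M ->
  exists a u N, M = block_mx (a%:M : 'M[R]_1) u u^T N :> 'M[R]_(1 + n).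
Proof.
case=> symM _; pose M' : 'M[R]_(1 + n) := M.
exists (ulsubmx M' ord0 ord0), (ursubmx M'), (drsubmx M').
rewrite -mx11_scalar trmx_ursub (_ : M'^T = M') ?submxK//.
Qed.

Variables (a : R) (u : 'rV[R]_n) (N : 'M[R]_n).
Let M : 'M[R]_n.+1 := block_mx (a%:M : 'M[R]_1) u u^T N.
Hypothesis pdM : posdefmx M.

(** The corner is the value of the quadratic form at the first basis vector. *)
Lemma posdefmx_corner_gt0 : 0 < a.
Proof.
have /(_ (col_mx (1%:M : 'M[R]_1) 0)) := pdM.2.
have /[swap] /[apply] : col_mx (1%:M : 'M[R]_1) 0 != 0 :> 'M[R]_(1 + n, 1).
  apply/eqP => /(congr1 usubmx); rewrite col_mxKu => /matrixP/(_ ord0 ord0)/eqP.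
  by rewrite !mxE eqxx oner_eq0.
rewrite /qform /M -mulmxA (@mul_block_col R 1 n 1 n 1) (@tr_col_mx R 1 n 1).
by rewrite (@mul_row_col R 1 1 n 1) !mulmx0 !mulmx1 trmx0 mul0mx !addr0
  trmx1 mul1mx mxE eqxx.
Qed.

Let a_neq0 : a != 0. Proof. exact/lt0r_neq0/posdefmx_corner_gt0. Qed.

Lemma posdefmx_schur : posdefmx (schur a u N).
Proof.
split.
  have := pdM.1; rewrite /M (@tr_block_mx R 1 n 1 n).
  move/(@eq_block_mx R 1 n 1 n) => [_ _ _ symN].
  by rewrite /schur linearB linearZ/= trmx_mul trmxK symN.
(* This [s] makes the first block of [M *m col_mx s t] vanish; the form of [M] there is the form of
   the Schur complement at [t]. *)
move=> t t0; pose s : 'M[R]_1 := - a^-1 *: (u *m t).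
have /(_ (col_mx s t)) := pdM.2.
have /[swap] /[apply] : col_mx s t != 0 :> 'M[R]_(1 + n, 1).
  apply: contra t0 => /eqP /(congr1 dsubmx).
  by rewrite col_mxKd => ->; apply/eqP/matrixP => i j; rewrite !mxE.
rewrite /qform /M -mulmxA (@mul_block_col R 1 n 1 n 1) (@tr_col_mx R 1 n 1)
  (@mul_row_col R 1 1 n 1).
have -> : a%:M *m s + u *m t = 0.
  by rewrite mul_scalar_mx scalerA mulrN divff// scaleN1r addNr.
rewrite mulmx0 add0r -mulmxA (_ : u^T *m s + N *m t = schur a u N *m t)//.
by rewrite mulmxBl addrC -scalemxAl -scalemxAr scaleNr mulmxA.
Qed.

(** Block elimination: [M] is a unit lower triangular block matrix times an upper triangular one
    with diagonal blocks [a] and the Schur complement. *)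
Lemma det_schur : \det M = a * \det (schur a u N).
Proof.
have -> : M =
    (block_mx (1%:M : 'M[R]_1) 0 (a^-1 *: u^T) 1%:M : 'M[R]_(1 + n)) *m
              block_mx (a%:M : 'M[R]_1) u 0 (schur a u N).
  rewrite mulmx_block !mul1mx !mul0mx !addr0 -!scalemxAl.
  by rewrite mul_mx_scalar scalerA mulVf// scale1r addrC subrK.
by rewrite det_mulmx (@det_lblock R 1 n) (@det_ublock R 1 n)
  !det1 !mul1r det_scalar1.
Qed.

End posdef_blocks.

Lemma posdefmx_det_gt0 (R : realType) n (M : 'M[R]_n) :
  posdefmx M -> 0 < \det M.
Proof.
elim: n M => [M _|n IH M pdM]; first by rewrite det_mx00.
have [a [u [N MN]]] := posdefmx_block pdM; rewrite MN in pdM *.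
rewrite det_schur// mulr_gt0 ?(posdefmx_corner_gt0 pdM)//.
exact/IH/posdefmx_schur.
Qed.

Lemma posdefmx_unit (R : realType) n (M : 'M[R]_n) : posdefmx M -> M \in unitmx.
Proof. by move=> /posdefmx_det_gt0 M0; rewrite unitmxE unitfE gt_eqF. Qed.

(** * Translations and positive definite linear maps *)

Section change_of_variables.
Local Open Scope ereal_scope.
Variable R : realType.

Lemma cV0_eq (x y : 'cV[R]_0) : x = y.
Proof. by apply/matrixP => -[]. Qed.

(** Induction on the dimension: the first coordinate is translated by the affine substitution of
    slope 1, the others by the induction hypothesis. *)
Lemma ge0_integral_vec_shift n (v : 'cV[R]_n) (f : 'cV[R]_n -> \bar R) :
    measurable_fun setT f -> (forall x, 0 <= f x) ->
  \int[@lebesgue_vec R n]_x f (x + v)%R = \int[@lebesgue_vec R n]_x f x.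
Proof.
elim: n v f => [v f mf f0|n IH v f mf f0].
  by apply: eq_integral => x _; rewrite (cV0_eq (x + v) x).
have mfv : measurable_fun setT (fun x : 'cV[R]_n.+1 => f (x + v)%R).
  apply: (measurableT_comp mf); apply: measurable_add_vec => //.
rewrite !ge0_integral_vcons//.
pose v' : 'cV[R]_(1 + n) := v.
pose g x := \int[@lebesgue_vec R n]_t f (vcons x t).
have mF : measurable_fun setT
    (fun z : measurableTypeR R * 'cV[R]_n => f (vcons z.1 z.2)).
  exact: (measurableT_comp mf (@measurable_vcons R n)).
have mg : measurable_fun setT g.
  by apply: (measurable_fun_fubini_tonelli_F
    (fun z : measurableTypeR R * 'cV[R]_n => f (vcons z.1 z.2))).
transitivity (\int[@lebesgue_measure R]_x g (1 * x + usubmx v' ord0 ord0)%R).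
  apply: eq_integral => x _.
  rewrite mul1r /g -[RHS](IH (dsubmx v')); last first.
  - by move=> t; exact: f0.
  - by apply: (measurableT_comp mf); exact: measurable_fun_vcons.
  apply: eq_integral => t _; congr f.
  rewrite /vcons raddfD/= -mx11_scalar -(@add_col_mx R 1 n 1 x%:M t).
  by rewrite (vsubmxK v').
rewrite -[LHS]mul1e ge0_integral_affine// => x.
exact: integral_ge0.
Qed.

(** Write the argument as [(x, t)]. For fixed [t], substituting for the first coordinate
    [a * x + u *m t] costs a factor [a] and turns the remaining block into [S *m t] plus a
    translation depending on [x] only. For fixed [x] the induction hypothesis for [S] then gives the
    factor [\det S]. *)
Lemma ge0_integral_posdefmx n (M : 'M[R]_n) (f : 'cV[R]_n -> \bar R) :
    posdefmx M -> measurable_fun setT f -> (forall x, 0 <= f x) ->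
  (\det M)%:E * \int[@lebesgue_vec R n]_x f (M *m x) =
  \int[@lebesgue_vec R n]_x f x.
Proof.
elim: n M f => [M f _ mf f0|n IH M f pdM mf f0].
  rewrite det_mx00 mul1e.
  by apply: eq_integral => x _; rewrite (cV0_eq (M *m x) x).
have mfM : measurable_fun setT (fun x => f (M *m x)).
  by apply: (measurableT_comp mf); exact: measurable_mulmx.
have [a [u [N MN]]] := posdefmx_block pdM; rewrite MN in pdM *.
have a0 := posdefmx_corner_gt0 pdM.
have pdS := posdefmx_schur pdM; set S := schur a u N in pdS.
rewrite det_schur// -/S.
(* [F1] is the integrand in the coordinates [(x, t)]; [F2] is what it becomes after the substitution
   in [x]. *)
pose F1 (z : measurableTypeR R * 'cV[R]_n) :=
  f (vcons (a * z.1 + (u *m z.2) ord0 ord0)%R (N *m z.2 + z.1 *: u^T)).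
pose F2 (z : measurableTypeR R * 'cV[R]_n) :=
  f (vcons z.1 (S *m z.2 + (a^-1 * z.1) *: u^T)).
have mF1 : measurable_fun setT F1.
  apply: (measurableT_comp mf); apply: measurable_fun_vcons.
    apply: measurable_funD; first exact: measurable_funM.
    apply: (measurableT_comp (measurable_coord _)).
    exact: measurable_mulmx.
  apply: measurable_add_vec; first exact: measurable_mulmx.
  exact: measurable_scale_vec.
have mF2 : measurable_fun setT F2.
  apply: (measurableT_comp mf); apply: measurable_fun_vcons => //.
  apply: measurable_add_vec; first exact: measurable_mulmx.
  by apply: measurable_scale_vec; exact: measurable_funM.
have F1_ge0 z : 0 <= F1 z by exact: f0.
have F2_ge0 z : 0 <= F2 z by exact: f0.
have -> : \int[@lebesgue_vec R n.+1]_x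
      f ((block_mx (a%:M : 'M[R]_1) u u^T N : 'M[R]_n.+1) *m x) =
    \int[@lebesgue_measure R]_x \int[@lebesgue_vec R n]_t F1 (x, t).
  rewrite ge0_integral_vcons//; last by rewrite -MN.
  apply: eq_integral => x _; apply: eq_integral => t _; congr f.
  rewrite /vcons (@mul_block_col R 1 n 1 n 1) mul_scalar_mx mul_mx_scalar/=.
  by rewrite scale_scalar_mx raddfD/= -mx11_scalar [(N *m t + _)%R]addrC.
rewrite fubini_tonelli//.
transitivity (a%:E * (\det S)%:E *
    \int[@lebesgue_vec R n]_t \int[@lebesgue_measure R]_x F1 (x, t)).
  by rewrite EFinM.
rewrite (muleC a%:E) -muleA -ge0_integralZl//; last 3 first.
- exact: (@measurable_fun_fubini_tonelli_G _ _ _ _ _ (@lebesgue_measure R)).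
- by move=> t _; exact: integral_ge0.
- by rewrite lee_fin ltW.
have -> : \int[@lebesgue_vec R n]_t
      (a%:E * \int[@lebesgue_measure R]_x F1 (x, t))
    = \int[@lebesgue_vec R n]_t \int[@lebesgue_measure R]_x F2 (x, t).
  apply: eq_integral => t _.
  rewrite -(@ge0_integral_affine _ a ((u *m t) ord0 ord0)
    (fun x => F2 (x, t)))//.
    congr (_ * _); apply: eq_integral => x _; rewrite /F1 /F2/=; congr f.
    congr (vcons _ _).
    (* The correction term in [S *m t] cancels the multiple of [u^T] coming from [u *m t]. *)
    rewrite mulmxBl -addrA; congr (_ + _)%R.
    rewrite mulrDr scalerDl mulKf ?gt_eqF// addrCA -scalemxAl -mulmxA.
    rewrite [X in (u^T *m X)%R]mx11_scalar mul_mx_scalar scalerA addNr addr0.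
    by [].
  exact: (measurableT_comp mF2 (pair2_measurable t)).
rewrite -(fubini_tonelli F2)// -ge0_integralZl//; last 3 first.
- exact: (@measurable_fun_fubini_tonelli_F _ _ _ _ _ (@lebesgue_vec R n)).
- by move=> x _; exact: integral_ge0.
- by rewrite lee_fin ltW// posdefmx_det_gt0.
rewrite ge0_integral_vcons//; apply: eq_integral => x _.
(* With [x] fixed, shift the right-hand integral, then apply the induction hypothesis to the shifted
   function [h]. *)
rewrite /F2/= -[RHS](ge0_integral_vec_shift ((a^-1 * x) *: u^T))//; last first.
  by apply: (measurableT_comp mf); exact: measurable_fun_vcons.
pose h (t : 'cV[R]_n) := f (vcons x (t + (a^-1 * x) *: u^T)).
rewrite -(IH S h)//; last by move=> t; exact: f0.
apply: (measurableT_comp mf); apply: measurable_fun_vcons => //.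
exact: measurable_add_vec.
Qed.

End change_of_variables.

(** * Gaussian integrals over ellipsoids *)

Section gaussian_ellipsoid.
Variables (R : realType) (d : nat).
Implicit Types (H M W Wh : 'M[R]_d) (v x : 'cV[R]_d).

Lemma enorm2_mx x : enorm x ^+ 2 = (x^T *m x) ord0 ord0.
Proof. by rewrite enorm2E mxE; apply: eq_bigr => i _; rewrite mxE. Qed.

Lemma invmx_conj Wh H : Wh \in unitmx -> H \in unitmx ->
  invmx (Wh *m invmx H *m Wh) = invmx Wh *m H *m invmx Wh.
Proof.
move=> uW uH; have uS : Wh *m invmx H *m Wh \in unitmx.
  by rewrite !unitmx_mul uW unitmx_inv uH.
apply: (can_inj (mulKmx uS)); rewrite mulmxV// !mulmxA mulmxK// mulmxKV//.
by rewrite mulmxV.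
Qed.

Lemma posdefmxZ (a : R) M : 0 < a -> posdefmx M -> posdefmx (a *: M).
Proof.
move=> a0 [sM pM]; split; first by rewrite linearZ/= sM.
by move=> v /pM v0; rewrite /qform -scalemxAr -scalemxAl mxE mulr_gt0.
Qed.

(** The inverse covariance is [H] conjugated by [invmx Wh], so both copies of [Wh] cancel. *)
Lemma qform_conj Wh H (a : R) x : posdefmx Wh -> posdefmx H ->
  qform (invmx (Wh *m invmx H *m Wh)) ((a *: Wh) *m x) = a ^+ 2 * qform H x.
Proof.
move=> pW pH; have uW := posdefmx_unit pW; have uH := posdefmx_unit pH.
rewrite invmx_conj// /qform trmx_mul linearZ/= pW.1 -!scalemxAl -!scalemxAr.
by rewrite -!scalemxAl !mulmxA mulmxK// mulmxKV// !mxE expr2 mulrA.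
Qed.

Lemma enorm2_sqrtmx W Wh (a : R) x : is_sqrtmx W Wh ->
  enorm ((a *: Wh) *m x) ^+ 2 = a ^+ 2 * qform W x.
Proof.
move=> [[sW _] WW]; rewrite enorm2_mx /qform trmx_mul linearZ/= sW -WW.
by rewrite -!scalemxAl -!scalemxAr -!scalemxAl !mulmxA !mxE expr2 mulrA.
Qed.

Lemma measurable_ellipsoid W (rho : R) v :
  measurable [set x | qform W (x - v) <= rho].
Proof.
rewrite (_ : [set _ | _] =
    (fun x => qform W (x + - v) : measurableTypeR R) @^-1` `]-oo, rho]).
  rewrite -[X in measurable X]setTI.
  apply: (measurableT_comp (measurable_qform W)) => //.
  exact: measurable_add_vec.
by apply/seteqP; split => x /=; rewrite in_itv.
Qed.

Lemma measurable_eball (rho : R) :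
  measurable [set x : 'cV[R]_d | enorm x ^+ 2 <= rho].
Proof.
rewrite (_ : [set _ | _] =
    (fun x : 'cV[R]_d => enorm x ^+ 2 : measurableTypeR R) @^-1` `]-oo, rho]).
  by rewrite -[X in measurable X]setTI; apply: measurable_enorm2.
by apply/seteqP; split => x /=; rewrite in_itv.
Qed.

Lemma measurable_mvnormal_pdf v M :
  measurable_fun setT (fun x => mvnormal_pdf v M x : measurableTypeR R).
Proof.
apply: measurable_funM => //; apply: measurableT_comp => //.
apply: measurable_funM => //; apply: measurableT_comp => //.
apply: (measurableT_comp (measurable_qform (invmx M))).
exact: measurable_add_vec.
Qed.

Lemma measurable_expR_qform H v (a : R) :
  measurable_fun setT (fun x => (expR (- qform H (x - v) / a))%:E).
Proof.
apply/measurable_EFinP; apply: measurableT_comp => //.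
apply: measurable_funM => //; apply: measurableT_comp => //.
apply: (measurableT_comp (measurable_qform H)).
exact: measurable_add_vec.
Qed.

Lemma sqrt_det_conj Wh H : posdefmx Wh -> posdefmx H ->
  Num.sqrt ((2 * pi) ^+ d * \det (Wh *m invmx H *m Wh)) =
  Num.sqrt (2 * pi) ^+ d * \det Wh / Num.sqrt (\det H).
Proof.
move=> /posdefmx_det_gt0 W0 /posdefmx_det_gt0 H0.
(* The right side is positive, hence the square root of its square; the radicands can then be
   compared. *)
rewrite -[RHS]gtr0_norm -?sqrtr_sqr; last first.
  by rewrite divr_gt0 ?sqrtr_gt0// mulr_gt0// exprn_gt0// sqrtr_gt0
    mulr_gt0 ?pi_gt0.
congr Num.sqrt.
rewrite expr_div_n [in RHS]exprMn -exprM mulnC exprM !sqr_sqrtr ?ltW//.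
  by rewrite !det_mulmx det_inv; ring.
by rewrite mulr_gt0 ?pi_gt0.
Qed.

(** Substitute [M *m (x - v)] with [M] equal to [Wh] divided by the square root of [c]: the
    ellipsoid becomes a Euclidean ball, the exponent that of the normal density. It serves with
    scale 1 for the upper bound and scale [c] for the lower one. *)
Lemma integral_expR_ellipsoid H W Wh v (c rho : R) :
    posdefmx H -> is_sqrtmx W Wh -> 0 < c ->
  (\int[@lebesgue_vec R d]_(x in [set x | (qform W (x - v) <= rho)%R])
      (expR (- qform H (x - v) / (2 * c)))%:E =
   (Num.sqrt c ^+ d * Num.sqrt (2 * pi) ^+ d / Num.sqrt (\det H))%:E *
   mvnormal_prob 0 (Wh *m invmx H *m Wh)
     [set x | (enorm x ^+ 2 <= rho / c)%R])%E.
Proof.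
move=> pH sWh c0; have pWh := sWh.1.
have H0 := posdefmx_det_gt0 pH; have Wh0 := posdefmx_det_gt0 pWh.
have sc0 : 0 < Num.sqrt c by rewrite sqrtr_gt0.
pose M := (Num.sqrt c)^-1 *: Wh.
have pM : posdefmx M by apply: posdefmxZ => //; rewrite invr_gt0.
pose A := [set x : 'cV[R]_d | enorm x ^+ 2 <= rho / c].
pose E := [set x | qform W (x - v) <= rho].
pose S := Wh *m invmx H *m Wh.
pose K := Num.sqrt ((2 * pi) ^+ d * \det S).
pose g := (fun x => (mvnormal_pdf 0 S x)%:E) \_ A.
pose e x := (expR (- qform H (x - v) / (2 * c)))%:E.
have K0 : 0 < K.
  rewrite /K sqrt_det_conj// divr_gt0 ?sqrtr_gt0// mulr_gt0// exprn_gt0//.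
  by rewrite sqrtr_gt0 mulr_gt0// pi_gt0.
have pdf_ge0 x : (0 <= (mvnormal_pdf 0 S x)%:E)%E.
  by rewrite lee_fin mulr_ge0 ?expR_ge0// invr_ge0 sqrtr_ge0.
have g0 x : (0 <= g x)%E by exact: erestrict_ge0.
have mg : measurable_fun setT g.
  apply/(measurable_restrictT _ (measurable_eball _)) => //.
  apply: measurable_funTS; apply/measurable_EFinP.
  exact: measurable_mvnormal_pdf.
have gM x : g (M *m (x - v)) = ((fun x => (K^-1)%:E * e x)%E \_ E) x.
  rewrite /g !patchE; have -> : (M *m (x - v) \in A) = (x \in E).
    apply/asbool_equiv_eq; rewrite /A /E /= (enorm2_sqrtmx _ _ sWh).
    rewrite exprVn sqr_sqrtr ?(ltW c0)//.
    by split; rewrite [_ * qform _ _]mulrC ler_pM2r ?invr_gt0.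
  case: ifP => [_|//]; rewrite /mvnormal_pdf -EFinM; congr (_ * expR _)%:E.
  rewrite subr0 qform_conj// exprVn sqr_sqrtr ?(ltW c0)//.
  by rewrite invfM -mulNr; ring.
have -> : mvnormal_prob 0 S A =
    ((\det M)%:E * ((K^-1)%:E * \int[@lebesgue_vec R d]_(x in E) e x))%E.
  rewrite /mvnormal_prob integral_mkcond -/g -(ge0_integral_posdefmx pM)//.
  rewrite -(ge0_integral_vec_shift (- v)); last 2 first.
  - by apply: (measurableT_comp mg); exact: measurable_mulmx.
  - by [].
  under eq_integral do rewrite gM.
  rewrite -integral_mkcond ge0_integralZl//.
  - exact: measurable_ellipsoid.
  - by apply: measurable_funTS; exact: measurable_expR_qform.
  - by move=> x _; rewrite lee_fin expR_ge0.
  - by rewrite lee_fin invr_ge0 ltW.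
rewrite !muleA -!EFinM -[LHS]mul1e; congr (_%:E * _)%E.
(* Both sides are now multiples of one integral; [\det Wh] cancels between the Jacobian and the
   normalizing constant. *)
rewrite detZ /K sqrt_det_conj// exprVn.
field.
rewrite !expf_neq0 ?gt_eqF//= ?sqrtr_gt0// mulr_gt0// pi_gt0.
by [].
Qed.

End gaussian_ellipsoid.

(** * Likelihood and posterior *)

Section extended_log.
Local Open Scope ereal_scope.
Variable R : realType.
Implicit Types x y : \bar R.

Lemma expeR_lneK x : 0 <= x -> expeR (lne x) = x.
Proof. by rewrite -lneK_eq => /eqP. Qed.

(* Also valid at 0, since 0 * +oo = 0 and -oo + +oo = -oo. *)
Lemma lneM_ge0 x y : 0 <= x -> 0 <= y -> lne (x * y) = lne x + lne y.
Proof.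
by move=> x0 y0; apply: expeR_inj; rewrite expeRD !expeR_lneK// mule_ge0.
Qed.

Lemma le_lne x y : 0 <= x -> x <= y -> lne x <= lne y.
Proof.
move=> x0 xy; rewrite -lee_expeR !expeR_lneK//; exact: le_trans xy.
Qed.

Lemma measurable_lne_EFin dT (T : measurableType dT) (f : T -> R) :
  measurable_fun setT f -> measurable_fun setT (fun t => lne (f t)%:E).
Proof.
move=> mf; apply: (measurableT_comp _ mf (f := fun r : R => lne r%:E)) => /=.
apply: measurable_fun_ifT => //.
  exact: measurable_fun_ler.
by apply/measurable_EFinP; exact: measurable_ln.
Qed.

(* An indeterminate difference such as +oo - +oo is -oo, of absolute value +oo. *)
Lemma abse_sub_fin_num x y (K : R) :
  `|x - y| <= K%:E -> x \is a fin_num /\ y \is a fin_num.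
Proof. by case: x y => [x| |] [y| |]. Qed.

End extended_log.

(** * High-probability events and the log-likelihood ratio *)

Section probability_events.
Local Open Scope ereal_scope.
Context dY (Y : measurableType dY) (R : realType) (P : probability Y R).

(** The integral is the difference of those of the positive and negative parts; it is finite only if
    both are, and their sum is the integral of the absolute value. *)
Lemma fin_num_integral_integrable (f : Y -> \bar R) : measurable_fun setT f ->
  \int[P]_y f y \is a fin_num -> P.-integrable setT f.
Proof.
move=> mf; rewrite integralE fin_numB => /andP[fp fn].
apply/integrableP; split => //.
rewrite (eq_integral (fun y => f^\+ y + f^\- y)); last first.
  by move=> y _; rewrite -[LHS]/((abse \o f) y) fune_abse.
rewrite ge0_integralD//; last 2 first.
  exact: measurable_funepos.
  exact: measurable_funeneg.
by rewrite lte_add_pinfty// ltey_eq ?fp ?fn.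
Qed.

Lemma prob_geI (A B : set Y) (a b : R) :
  prob_ge P A (1 - a) -> prob_ge P B (1 - b) ->
  prob_ge P (A `&` B) (1 - a - b).
Proof.
move=> [E [mE EA PE]] [F [mF FB PF]].
have mEF := measurableI _ _ mE mF.
exists (E `&` F); split; [by []|exact: setISS|].
(* Union bound: what [E] loses by intersecting with [F] lies in the complement of [F]. *)
have : P (E `\` (E `&` F)) <= b%:E.
  rewrite setDIr setDv set0U.
  apply: (@le_trans _ _ (P (~` F))).
    by apply: le_measure; rewrite ?inE; [exact: measurableD|exact: measurableC|].
  rewrite probability_setC// leeBlDr ?fin_num_measure// -leeBlDl// -EFinB.
rewrite measureD//; last first.
  by rewrite (le_lt_trans (probability_le1 _ mE))// ltry.
rewrite setIA setIid leeBlDr ?fin_num_measure// => le.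
by have := le_trans PE le; rewrite -leeBlDl.
Qed.

(** The difference of values is the centered difference plus the difference of means. The real bound
    [K] forces all four terms to be finite, so [f] and [g] are integrable and the integral of
    [f - g] splits. *)
Lemma loglik_diff_bounds (f g : Y -> \bar R) (y : Y) (K a b : R) :
  measurable_fun setT f -> measurable_fun setT g ->
  `|(f y - \int[P]_z f z) - (g y - \int[P]_z g z)| <= K%:E ->
  a%:E <= - (\int[P]_z (f z - g z)) <= b%:E ->
  exists u v, [/\ f y = u%:E, g y = v%:E, (v - K - b <= u)%R
    & (u <= v + K - a)%R].
Proof.
move=> mf mg yK; have [] := abse_sub_fin_num yK.
rewrite fin_numB => /andP[fy Ef]; rewrite fin_numB => /andP[gy Eg].
rewrite integralB//; [|exact: fin_num_integral_integrable..].
move: yK; rewrite -(fineK fy) -(fineK gy) -(fineK Ef) -(fineK Eg).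
rewrite -!EFinB -EFinN !lee_fin ler_norml => /andP[h1 h2] /andP[h3 h4].
exists (fine (f y)), (fine (g y)); split => //; lra.
Qed.

End probability_events.

(** * Measurability of the posterior integrand *)

Section measurability_posterior.
Variables (R : realType) (d : nat).

Lemma closed_measurable_matrix m n (A : set 'M[R]_(m, n)) :
  closed A -> measurable A.
Proof.
move=> cA; rewrite -[A]setCK; apply: measurableC.
by apply: open_measurable_matrix; exact: closed_openC.
Qed.

Lemma within_continuous_measurable (A : set 'cV[R]_d) (f : 'cV[R]_d -> R) :
  closed A -> {within A, continuous f} ->
  measurable_fun A (f : 'cV[R]_d -> measurableTypeR R).
Proof.
move=> cA /continuousP cf mA.
apply: (measurability (@RGenOInfty.G R)) => //.
  exact: RGenOInfty.measurableE.
move=> _ [_ [a ->] <-].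
have oa : open (`]a, +oo[%classic : set R) by exact: rray_open.
have /open_subspaceP[V oV VA] := cf _ oa.
rewrite setIC -[X in measurable X]VA; apply: measurableI => //.
exact: open_measurable_matrix.
Qed.

Context dY (Y : measurableType dY).
(** As densities are nonnegative, [expeR] undoes [lne]; the likelihood at [y] is then a section of
    the jointly measurable density. *)
Lemma measurable_unnormalized (Theta : set 'cV[R]_d) (p : 'cV[R]_d -> Y -> R)
    (prior : 'cV[R]_d -> R) (y : Y) :
  closed Theta -> (forall theta, Theta theta -> 0 <= p theta y) ->
  measurable_fun ([set: Y] `*` Theta) (fun z : Y * 'cV[R]_d => p z.2 z.1) ->
  {within Theta, continuous prior} ->
  measurable_fun Theta
    (fun theta => (expeR (loglik p theta y) * (prior theta)%:E)%E).
Proof.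
move=> cT p0 mp cprior; have mT := closed_measurable_matrix cT.
apply: (eq_measurable_fun (fun theta => (p theta y * prior theta)%:E)).
  move=> t /[!inE] Tt.
  by rewrite /loglik expeR_lneK ?lee_fin ?p0.
apply/measurable_EFinP; apply: measurable_funM; last first.
  exact: within_continuous_measurable.
move=> _ B mB.
have mD : measurable ([set: Y] `*` Theta) by exact: measurableX.
have := pair1_measurable y measurableT (mp mD B mB).
rewrite setTI; congr measurable; apply/seteqP; split => t /=.
  by move=> [[_ Tt] Bt].
by move=> [Tt Bt].
Qed.

End measurability_posterior.

(* Here 0 / 0 = x / +oo = 0, so that the hypothesis forces 0 < y < +oo. *)
Lemma le_div_of_le_ratio (R : realType) (a : R) (x y : \bar R) :
  0 < a -> (0 <= x -> x <= y -> a%:E <= x / y -> y <= x / a%:E)%E.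
Proof.
move=> a0; rewrite inver gt_eqF//.
case: x y => [x| |] [y| |]//=; rewrite ?lee_fin.
- move=> x0 xy; rewrite inver; case: eqP => [y0|/eqP y0].
    have -> : x = 0 by apply/eqP; rewrite eq_le x0 -y0 xy.
    by rewrite mul0e lee_fin leNgt a0.
  have y_gt0 : 0 < y by rewrite lt_neqAle eq_sym y0 (le_trans x0).
  by rewrite -!EFinM !lee_fin ler_pdivlMr// ler_pdivlMr// mulrC.
- by move=> _ _; rewrite mulr0 leNgt a0.
- by move=> _ _; rewrite invey mule0 lee_fin leNgt a0.
Qed.

(** Used with the logarithms of the scale and of [2 * pi] as [a] and [b]. The terms [x] and [y] are
    logarithms that may be infinite, hence the case analysis. *)
Lemma log_bound_rearrange (R : realType) (d : nat) (l C a b h : R)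
    (x y : \bar R) :
  ((l + C * d%:R)%:E + x + ((a / 2 *+ d + b / 2 *+ d - h)%:E + y) =
  l%:E - h%:E + (((C + b / 2 + a / 2) * d%:R)%:E + x + y))%E.
Proof.
case: x y => [x| |] [y| |] //; rewrite -!EFinD; congr _%:E.
by rewrite -[a / 2 *+ d]mulr_natr -[b / 2 *+ d]mulr_natr; ring.
Qed.

Lemma ln_sqrt (R : realType) (b : R) : 0 < b -> ln (Num.sqrt b) = ln b / 2.
Proof.
move=> b0; rewrite -[in RHS](sqr_sqrtr (ltW b0)) lnXn ?sqrtr_gt0//.
by rewrite -[X in X / 2]mulr_natr mulfK.
Qed.

Lemma ln_gaussian_constant (R : realType) (d : nat) (a b D : R) :
  0 < a -> 0 < b -> 0 < D ->
  ln (Num.sqrt a ^+ d * Num.sqrt b ^+ d / Num.sqrt D) =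
  ln a / 2 *+ d + ln b / 2 *+ d - ln D / 2.
Proof.
move=> a0 b0 D0.
rewrite ln_div ?posrE ?sqrtr_gt0// ?mulr_gt0 ?exprn_gt0 ?sqrtr_gt0//.
rewrite lnM ?posrE ?exprn_gt0 ?sqrtr_gt0// !lnXn ?sqrtr_gt0//.
by rewrite !ln_sqrt.
Qed.

Theorem theorem1 (R : realType) (d : nat) (d_gt0 : (0 < d)%N)
  (* statistical model *)
  (dY : measure_display) (Y : measurableType dY)
  (mu : {sigma_finite_measure set Y -> \bar R})
  (Theta : set 'cV[R]_d)
  (Theta_closed : closed Theta) (Theta_convex : convex_set Theta)
  (PP : 'cV[R]_d -> probability Y R) (p : 'cV[R]_d -> Y -> R)
  (p_density : forall theta, Theta theta -> is_density mu (PP theta) (p theta))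
  (p_measurable : measurable_fun ([set: Y] `*` Theta)
     (fun z : Y * 'cV[R]_d => p z.2 z.1))
  (* true distribution and pseudo-true parameter *)
  (P : probability Y R) (p0 : Y -> R)
  (P_dominated : P `<< mu) (P_density : is_density mu P p0)
  (theta_s : 'cV[R]_d) (theta_sP : pseudo_true p mu P p0 Theta theta_s)
  (* proper prior density *)
  (prior : 'cV[R]_d -> R)
  (prior_ge0 : forall theta, Theta theta -> 0 <= prior theta)
  (prior_proper :
     (\int[@lebesgue_vec R d]_(theta in Theta) (prior theta)%:E = 1)%E)
  (* parameters of B^* *)
  (W : 'M[R]_d) (W_posdef : posdefmx W) (r : R) (r_gt0 : 0 < r)
  (* (1) deterministic part of the likelihood ratio *)
  (H : 'M[R]_d) (H_posdef : posdefmx H)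
  (c : R) (c_bounds : 1 / 2 < c < 1)
  (deterministic : forall theta, Bstar Theta W r theta_s theta ->
     ((qform H (theta - theta_s) / 2)%:E
        <= - (\int[P]_y loglik_ratio p theta theta_s y)
        <= (qform H (theta - theta_s) / (2 * c))%:E)%E)
  (* (2) stochastic part of the likelihood ratio *)
  (C : R) (C_gt0 : 0 < C)
  (tdelta : R) (tdelta_bounds : 0 < tdelta < 1 / 4)
  (stochastic : prob_ge P
     [set y | (ereal_sup [set `|centered_loglik p P theta y -
                               centered_loglik p P theta_s y|
                       | theta in Bstar Theta W r theta_s]
         <= (C * d%:R)%:E)%E]
     (1 - tdelta))
  (* (3) prior *)
  (prior_continuous : {within Theta, continuous prior})
  (prior_neq0 : forall theta, Theta theta -> prior theta != 0)
  (* (4) posterior concentration *)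
  (eta : R) (eta_bounds : 0 < eta < 1 / 4)
  (delta : R) (delta_bounds : 0 < delta < 1 / 4)
  (concentration : prob_ge P
     [set y | ((1 - eta)%:E <= posterior p Theta prior y
                          (Bstar Theta W r theta_s))%E]
     (1 - delta))
  (* the normal vector xi, with Wh = W^{1/2} *)
  (Wh : 'M[R]_d) (WhP : is_sqrtmx W Wh)
  (dO : measure_display) (Omega : measurableType dO)
  (Q : probability Omega R) (xi : {mfun Omega >-> 'cV[R]_d})
  (xi_normal : forall A, measurable A ->
     distribution Q xi A = mvnormal_prob 0 (Wh *m invmx H *m Wh) A) :
  prob_ge P
    [set y |
      (lne (marginal_likelihood p Theta prior y) <=
         loglik p theta_s y - (ln (\det H) / 2)%:E +
         (((C + ln (2 * pi) / 2) * d%:R)%:E +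
          lne (ereal_sup [set (prior theta)%:E
                           | theta in Bstar Theta W r theta_s] / (1 - eta)%:E) +
          lne (Q [set w | (enorm (xi w) ^+ 2 <= r * d%:R)%R])))%E
      /\
      (* this bound fails if Theta cuts through the ellipsoid *)
      (ellipsoid W r theta_s `<=` Theta ->
       (loglik p theta_s y - (ln (\det H) / 2)%:E +
         (((- C + ln (2 * pi) / 2 + ln c / 2) * d%:R)%:E +
          lne (ereal_inf [set (prior theta)%:E
                           | theta in Bstar Theta W r theta_s]) +
          lne (Q [set w | (enorm (xi w) ^+ 2 <= r * c^-1 * d%:R)%R]))
        <= lne (marginal_likelihood p Theta prior y))%E)]
    (1 - delta - tdelta).

Proof.
set B := Bstar Theta W r theta_s; set E := ellipsoid W r theta_s.
have mT := closed_measurable_matrix Theta_closed.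
have mE : measurable E by exact: measurable_ellipsoid.
have mB : measurable B by exact: measurableI.
have BT : B `<=` Theta by exact: subIsetl.
have BE : B `<=` E by exact: subIsetr.
have Bs : B theta_s.
  split; first by case: theta_sP.
  by rewrite /ellipsoid/= subrr /qform mulmx0 mxE mulr_ge0// ltW.
have c0 : 0 < c by lra.
have H0 := posdefmx_det_gt0 H_posdef.
have pi2 : 0 < 2 * pi :> R by rewrite mulr_gt0 ?pi_gt0.
have ml theta : Theta theta -> measurable_fun setT (loglik p theta).
  by move=> /p_density[mp _ _]; exact: measurable_lne_EFin.
have Qball rho : Q [set w | (enorm (xi w) ^+ 2 <= rho)%R] =
    mvnormal_prob 0 (Wh *m invmx H *m Wh) [set x | (enorm x ^+ 2 <= rho)%R].
  by rewrite -xi_normal//; exact: measurable_eball.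
(* Fix an event on which concentration and the stochastic bound both hold; from here on the argument
   is deterministic in [y]. *)
have := prob_geI concentration stochastic.
move=> [F [mF FAB PF]]; exists F; split => //; apply: subset_trans FAB _.
move=> y [/= post sup_le].
have lb theta : B theta -> exists u v, [/\ loglik p theta y = u%:E,
    loglik p theta_s y = v%:E,
    v - C * d%:R - qform H (theta - theta_s) / (2 * c) <= u &
    u <= v + C * d%:R - qform H (theta - theta_s) / 2].
  move=> Bt; apply: (@loglik_diff_bounds _ _ _ P _ _ y (C * d%:R)).
  - exact/ml/BT.
  - exact/ml/BT.
  - by apply: le_trans sup_le; apply: ereal_sup_ubound; exists theta.
  - exact: deterministic.
(* As [theta_s] lies in [B], its log-likelihood is a real number [l]. *)
have [_ [l [_ ls _ _]]] := lb _ Bs; rewrite ls.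
pose u theta := (expeR (loglik p theta y) * (prior theta)%:E)%E.
have mu' : measurable_fun Theta u.
  apply: measurable_unnormalized => // t /p_density[_ + _]; exact.
have u_ge0 t : Theta t -> (0 <= u t)%E.
  by move=> Tt; rewrite mule_ge0 ?expeR_ge0// lee_fin prior_ge0.
have U_ge0 A : A `<=` Theta -> (0 <= unnormalized_posterior p prior y A)%E.
  by move=> AT; apply: integral_ge0 => t /AT; exact: u_ge0.
set Z := marginal_likelihood p Theta prior y.
have Z_ge0 : (0 <= Z)%E by exact: U_ge0.
have UBZ : (unnormalized_posterior p prior y B <= Z)%E.
  exact: ge0_subset_integral.
pose e a (x : 'cV[R]_d) := (expR (- qform H (x - theta_s) / (2 * a)))%:E.
have e_ge0 a x : (0 <= e a x)%E by rewrite lee_fin expR_ge0.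
have me a : measurable_fun setT (e a) by exact: measurable_expR_qform.
pose k a := Num.sqrt a ^+ d * Num.sqrt (2 * pi) ^+ d / Num.sqrt (\det H).
have k0 a : 0 < a -> 0 < k a.
  move=> a0; rewrite divr_gt0 ?sqrtr_gt0// mulr_gt0// exprn_gt0// sqrtr_gt0//.
have lnk a : 0 < a ->
    ln (k a) = ln a / 2 *+ d + ln (2 * pi) / 2 *+ d - ln (\det H) / 2.
  by move=> a0; exact: ln_gaussian_constant.
have Ie a : 0 < a -> (\int[@lebesgue_vec R d]_(x in E) e a x =
    (k a)%:E * Q [set w | (enorm (xi w) ^+ 2 <= r * a^-1 * d%:R)%R])%E.
  move=> a0; rewrite Qball (integral_expR_ellipsoid _ _ H_posdef WhP a0).
  by rewrite [r * a^-1 * _]mulrAC.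
have Q_ge0 A : (0 <= Q A)%E by exact: measure_ge0.
split.
- set S := ereal_sup _.
  have S_ge0 : (0 <= S)%E.
    apply: (@le_trans _ _ (prior theta_s)%:E).
      by rewrite lee_fin prior_ge0//; exact: BT.
    by apply: ereal_sup_ubound; exists theta_s.
  (* Bound the likelihood by its Gaussian majorant and the prior by [S], possibly infinite, then
     enlarge [B] to the full ellipsoid. *)
  have UB : (unnormalized_posterior p prior y B <=
      (expR (l + C * d%:R))%:E * S * ((k 1)%:E *
        Q [set w | (enorm (xi w) ^+ 2 <= r * d%:R)%R]))%E.
    have := Ie 1 ltr01; rewrite invr1 mulr1 => <-.
    rewrite -ge0_integralZl//; last 2 first.
    + exact: measurable_funTS.
    + by rewrite mule_ge0// lee_fin expR_ge0.
    apply: (@le_trans _ _ (\int[@lebesgue_vec R d]_(x in B)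
        ((expR (l + C * d%:R)%R)%:E * S * e 1%R x))%E).
      apply: ge0_le_integral => //.
      + by move=> t /BT; exact: u_ge0.
      + exact: measurable_funS mu'.
      + by apply: measurable_funeM; exact: measurable_funTS.
      move=> t Bt; rewrite /u /e; have [v [l' [-> ls' _ vle]]] := lb _ Bt.
      move: ls'; rewrite ls => -[?]; subst l'.
      rewrite muleAC -[X in (_ <= X * _)%E]EFinM -expRD; apply: lee_pmul.
      * exact: expeR_ge0.
      * by rewrite lee_fin prior_ge0//; exact: BT.
      * by rewrite /= lee_fin ler_expR mulr1 mulNr.
      * by apply: ereal_sup_ubound; exists t.
    apply: ge0_subset_integral => //.
      by apply: measurable_funeM; exact: measurable_funTS.
    by move=> t _; rewrite !mule_ge0// lee_fin expR_ge0.
  have kQ_ge0 : (0 <= (k 1)%:E *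
      Q [set w | (enorm (xi w) ^+ 2 <= r * d%:R)%R])%E.
    by rewrite mule_ge0// lee_fin ltW// k0.
  have Sa_ge0 : (0 <= S / (1 - eta)%:E)%E.
    by rewrite mule_ge0// inve_ge0 lee_fin; lra.
  (* Concentration bounds [Z] by the mass of [B] divided by [1 - eta]. *)
  have : (Z <= (expR (l + C * d%:R))%:E * (S / (1 - eta)%:E) * ((k 1)%:E *
        Q [set w | (enorm (xi w) ^+ 2 <= r * d%:R)%R]))%E.
    have a0 : 0 < 1 - eta by lra.
    apply: (le_trans (le_div_of_le_ratio a0 (U_ge0 _ BT) UBZ post)).
    rewrite (muleA _ S) [leRHS]muleAC; apply: lee_wpmul2r => //.
    by rewrite inve_ge0 lee_fin ltW.
  move=> /(le_lne Z_ge0)/le_trans; apply.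
  have X_ge0 : (0 <= (expR (l + C * d%:R))%:E)%E by rewrite lee_fin expR_ge0.
  rewrite (lneM_ge0 (mule_ge0 X_ge0 Sa_ge0) kQ_ge0).
  rewrite lneM_ge0// lne_EFin ?expR_gt0// expRK.
  rewrite (@lneM_ge0 _ (k 1)%:E) ?lee_fin ?(ltW (k0 _ _))//.
  rewrite lne_EFin ?k0// lnk// ln1 log_bound_rearrange.
  by rewrite mul0r addr0.
- move=> ET.
  have EB : E `<=` B by move=> t Et; split => //; exact: ET.
  set m := ereal_inf _.
  have m_ge0 : (0 <= m)%E.
    apply: le_ereal_inf_tmp => _ [t Bt <-].
    by rewrite lee_fin prior_ge0//; exact: BT.
  (* The mass of [B] is at most [Z], and on [B] the integrand dominates a Gaussian of scale [c]
     times [m]. The inclusion [ET] makes [B] the full ellipsoid, over which the Gaussian integral is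
     known. *)
  have ZB : ((expR (l - C * d%:R))%:E * m * ((k c)%:E *
        Q [set w | (enorm (xi w) ^+ 2 <= r * c^-1 * d%:R)%R]) <= Z)%E.
    apply: le_trans UBZ.
    rewrite -Ie// -ge0_integralZl//; last 2 first.
    + exact: measurable_funTS.
    + by rewrite mule_ge0// lee_fin expR_ge0.
    have -> : E = B by apply/seteqP.
    apply: ge0_le_integral => //.
    + by move=> t _; rewrite !mule_ge0// lee_fin expR_ge0.
    + by apply: measurable_funeM; exact: measurable_funTS.
    + exact: measurable_funS mu'.
    move=> t Bt; rewrite /u /e; have [v [l' [-> ls' lev _]]] := lb _ Bt.
    move: ls'; rewrite ls => -[?]; subst l'.
    rewrite muleAC -[X in (X * _ <= _)%E]EFinM -expRD; apply: lee_pmul.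
    + by rewrite lee_fin expR_ge0.
    + exact: m_ge0.
    + by rewrite /= lee_fin ler_expR mulNr.
    + by apply: ereal_inf_lbound; exists t.
  have kQ_ge0 : (0 <= (k c)%:E *
      Q [set w | (enorm (xi w) ^+ 2 <= r * c^-1 * d%:R)%R])%E.
    by rewrite mule_ge0// lee_fin ltW// k0.
  have X_ge0 : (0 <= (expR (l - C * d%:R))%:E)%E by rewrite lee_fin expR_ge0.
  apply: le_trans (le_lne (mule_ge0 (mule_ge0 X_ge0 m_ge0) kQ_ge0) ZB).
  rewrite (lneM_ge0 (mule_ge0 X_ge0 m_ge0) kQ_ge0).
  rewrite lneM_ge0// lne_EFin ?expR_gt0// expRK -(mulNr C).
  rewrite (@lneM_ge0 _ (k c)%:E) ?lee_fin ?(ltW (k0 _ _))//.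
  by rewrite lne_EFin ?k0// lnk// log_bound_rearrange.
Qed.
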